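(* Let $\epsilon>0$ and consider the planar system $$\dot{x}=(1-x^2)(x-y),\qquad \dot{y}=\epsilon x .$$ Let $R=\{(-1,y): y<-1\}\cup\{(1,y): y>1\}$ be the repulsive part of the slow manifold. Then for every initial point $(x_0,y_0)\in\mathbb{R}^2$ with $-1<x_0<1$, for every $\delta>0$ and every $T>0$, the solution $(x(t),y(t))$, $t\ge 0$, with $(x(0),y(0))=(x_0,y_0)$ spends a time larger than $T$ within a distance less than $\delta$ of $R$; that is, there is a time interval $I\subset[0,+\infty)$ of length larger than $T$ such that $\operatorname{dist}((x(t),y(t)),R)<\delta$ for all $t\in I$.
   Context: The system is a slow-fast system with fast variable $x$ and slow variable $y$. The fast dynamics is $\dot x=(1-x^2)(x-y)$ with $y$ regarded as a constant parameter; its equilibrium set (the slow, or critical, manifold) consists of the lines $x=-1$, $x=1$ and $y=x$. On the boundary lines of the strip $-1<x<1$, the equilibrium $x=-1$ of the fast dynamics is repulsive for $y<-1$, and the equilibrium $x=1$ is repulsive for $y>1$. The repulsive part of the slow manifold referred to in the claim is the union $R$ of these two half-lines. Distance is the Euclidean distance in $\mathbb{R}^2$.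
   Formalization: The initial point (0,0) is excluded: it is an equilibrium, and its constant solution stays at distance √2 from R, so the claim as stated fails there (for example with δ = 1). *)

(* Defs.v *)
From Stdlib Require Import Reals.
From Coquelicot Require Import Coquelicot.
Open Scope R_scope.

(* Derivative at [t] of a function considered on [0, +oo) only: it is the usual
   derivative for t > 0 and the right derivative for t = 0. *)
Definition is_derive_nonneg (f : R -> R) (t l : R) : Prop :=
  filterdiff f (within (fun s => 0 <= s) (locally t)) (fun h => scal h l).

Definition is_solution (eps : R) (x y : R -> R) : Prop :=
  forall t, 0 <= t ->
    is_derive_nonneg x t ((1 - x t ^ 2) * (x t - y t)) /\
    is_derive_nonneg y t (eps * x t).

Definition repulsive_part (p : R * R) : Prop :=
  (fst p = -1 /\ snd p < -1) \/ (fst p = 1 /\ 1 < snd p).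

Definition dist_to_set (p : R * R) (S : R * R -> Prop) : Rbar :=
  Glb_Rbar (fun d => exists q, S q /\ d = dist_euc (fst p) (snd p) (fst q) (snd q)).

(* Main.v *)
Require Import Defs.
From Stdlib Require Import Reals.
From Coquelicot Require Import Coquelicot.
From Stdlib Require Import Lra Psatz Classical.
Open Scope R_scope.

(** The strip is invariant, and on it the system has the Lyapunov-type function
    H = y^2/2 - (eps/2) ln (1 - x^2), with H' = eps x^2 >= 0; H vanishes only at
    the equilibrium (0,0), and it blows up at the boundary of the strip.

    H tends to infinity along every solution other than the equilibrium
    ([energy_unbounded]).  Indeed V = (1 + 2/eps) H - x y satisfies
    V' >= (1 - x^2)(x^2 + y^2)/2.  If H stayed below a bound, 1 - x^2 would stay
    away from 0, and so would x^2 + y^2 because H is at least its positive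
    initial value; then V would grow linearly, although H bounds it.

    On the other hand y cannot stay above 1, nor below -1, so the solution
    returns to -1 <= y <= 1 at arbitrarily late times ([y_recurrent]).  At such
    times a large H forces x to be very close to 1 or to -1
    ([energy_confines]); by the symmetry (x,y) -> (-x,-y) take x near 1.  Then y
    increases until it reaches 1 with x still near 1 ([reaches_one]), and the
    solution starts to follow the repulsive half-line x = 1, y > 1.  The
    half-line repels at a rate of order y, and y grows at rate at most eps, so
    over a time L the distance 1 - x is multiplied by at most a constant
    depending on eps and L only ([stays_near_one]).  Since 1 - x is as small as
    desired at the start, it stays below delta during that time. *)

(** * Calculus on an interval *)

Lemma increment_ge (f df : R -> R) (c a b : R) :
  a <= b -> (forall t, a <= t <= b -> is_derive f t (df t)) ->
  (forall t, a <= t <= b -> c <= df t) -> f a + c * (b - a) <= f b.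
Proof.
  intros hab hf hc.
  destruct (MVT_gen f a b df) as [t [ht heq]].
  - intros t ht. rewrite Rmin_left, Rmax_right in ht by lra. apply hf; lra.
  - intros t ht. rewrite Rmin_left, Rmax_right in ht by lra.
    apply continuity_pt_filterlim, (ex_derive_continuous f t).
    exists (df t); apply hf; lra.
  - rewrite Rmin_left, Rmax_right in ht by lra.
    specialize (hc t ht). nra.
Qed.

(** The intermediate value theorem does not control the sign of f before the
    zero; the differential inequalities below hold only as long as f keeps its
    sign. *)
Lemma zero_before_sign_change (f : R -> R) (a b : R) :
  a <= b -> (forall t, a <= t <= b -> continuity_pt f t) ->
  0 < f a -> f b <= 0 ->
  exists c, a <= c <= b /\ f c = 0 /\ forall t, a <= t <= c -> 0 <= f t.
Proof.
  intros hab hf ha hb.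
  (* The witness is the end of the longest initial interval on which f is
     nonnegative; it is a zero even if f touched 0 earlier. *)
  set (E := fun c => a <= c <= b /\ forall t, a <= t <= c -> 0 <= f t).
  destruct (completeness E) as [c [hup hleast]].
  { exists b. intros z [hz _]; lra. }
  { exists a. split; [lra|]. intros t ht. replace t with a by lra. lra. }
  assert (hac : a <= c).
  { apply hup. split; [lra|]. intros t ht. replace t with a by lra. lra. }
  assert (hcb : c <= b) by (apply hleast; intros z [hz _]; lra).
  assert (hbelow : forall t, a <= t < c -> 0 <= f t).
  { intros t ht. apply NNPP; intro hn.
    assert (c <= t); [|lra].
    apply hleast. intros z [hz hz']. apply Rnot_lt_le; intro hlt.
    apply hn, hz'. lra. }
  assert (hcont := proj1 (continuity_pt_locally f c) (hf c (conj hac hcb))).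
  assert (hc : f c = 0).
  { destruct (Rtotal_order (f c) 0) as [hneg|[h0|hpos]]; [|exact h0|]; exfalso.
    - assert (a < c) by (destruct hac as [|e]; [lra|rewrite <- e in hneg; lra]).
      assert (hp : 0 < - f c) by lra.
      destruct (hcont (mkposreal _ hp)) as [d hd]; simpl in hd.
      set (t := Rmax a (c - d / 2)).
      assert (ht : a <= t < c /\ c - d / 2 <= t).
      { unfold t, Rmax. generalize (cond_pos d). destruct (Rle_dec a (c - d/2)); lra. }
      assert (hb' : ball c d t).
      { change (Rabs (t - c) < d). apply Rabs_def1; generalize (cond_pos d); lra. }
      apply hd, Rabs_def2 in hb'. generalize (hbelow t (proj1 ht)). lra.
    - assert (c < b) by (destruct hcb as [|e]; [lra|rewrite e in hpos; lra]).
      destruct (hcont (mkposreal _ hpos)) as [d hd]; simpl in hd.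
      set (z := Rmin b (c + d / 2)).
      assert (hz : c < z <= b /\ z <= c + d / 2).
      { unfold z, Rmin. generalize (cond_pos d). destruct (Rle_dec b (c + d/2)); lra. }
      assert (z <= c); [|lra].
      apply hup. split; [lra|]. intros t ht.
      destruct (Rlt_le_dec t c) as [h|h]; [apply hbelow; lra|].
      assert (hb' : ball c d t).
      { change (Rabs (t - c) < d). apply Rabs_def1; generalize (cond_pos d); lra. }
      apply hd, Rabs_def2 in hb'. lra. }
  exists c. repeat split; [lra|lra|exact hc|].
  intros t ht. destruct (Rlt_le_dec t c) as [h|h]; [apply hbelow; lra|].
  replace t with c by lra. lra.
Qed.

Lemma exp_monotone (a b : R) : a <= b -> exp a <= exp b.
Proof.
  intros [h|h]; [left; apply exp_increasing, h|right; rewrite h; reflexivity].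
Qed.

(** * Two-sided solutions *)

(** Unlike [is_solution], this asks for a two-sided derivative at time 0, so that
    the usual calculus applies on every interval [0, b]. *)
Definition solves (eps : R) (x y : R -> R) : Prop :=
  forall t, 0 <= t ->
    is_derive x t ((1 - x t ^ 2) * (x t - y t)) /\ is_derive y t (eps * x t).

(** Continuing f to negative times along a line of slope l turns the right
    derivative l at 0 into a two-sided one. *)
Definition extend (f : R -> R) (l t : R) : R :=
  if Rlt_dec t 0 then f 0 + t * l else f t.

Lemma extend_eq (f : R -> R) (l t : R) : 0 <= t -> extend f l t = f t.
Proof. intros ht. unfold extend. destruct (Rlt_dec t 0); lra. Qed.

Lemma is_derive_extend (f : R -> R) (l0 t l : R) :
  0 <= t -> (t = 0 -> l = l0) ->
  is_derive_nonneg f t l -> is_derive (extend f l0) t l.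
Proof.
  intros ht hl [_ hf]. split; [apply is_linear_scal_l|].
  intros z hz. rewrite <- (is_filter_lim_locally_unique t z hz). clear z hz.
  intros e.
  assert (hlim : is_filter_lim (within (fun s => 0 <= s) (locally t)) t).
  { intros P hP. unfold within. apply filter_imp with (2 := hP). auto. }
  specialize (hf t hlim e). unfold within in hf.
  rewrite (extend_eq f l0 t ht).
  destruct ht as [ht|ht].
  - assert (hpos : locally t (fun s => 0 < s)) by (apply (open_gt 0 t ht)).
    generalize (filter_and _ _ hf hpos). apply filter_imp.
    intros s [h1 h2]. rewrite extend_eq by lra. apply h1; lra.
  - subst t. rewrite (hl eq_refl) in *.
    revert hf. apply filter_imp. intros s h1.
    unfold extend. destruct (Rlt_dec s 0) as [hs|hs]; [|apply h1; lra].
    match goal with |- norm ?u <= _ => assert (hu : u = 0) end.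
    { unfold minus, plus, opp, scal; simpl. unfold mult; simpl. ring. }
    rewrite hu.
    match goal with |- _ <= ?v => change (Rabs 0 <= v) end. rewrite Rabs_R0.
    apply Rmult_le_pos; [apply Rlt_le, cond_pos|apply norm_ge_0].
Qed.

Lemma solution_extends (eps : R) (x y : R -> R) :
  is_solution eps x y ->
  exists X Y, solves eps X Y /\ forall t, 0 <= t -> X t = x t /\ Y t = y t.
Proof.
  intros h.
  set (X := extend x ((1 - x 0 ^ 2) * (x 0 - y 0))).
  set (Y := extend y (eps * x 0)).
  exists X, Y. split.
  - intros t ht. unfold X, Y. rewrite !extend_eq by lra.
    destruct (h t ht) as [h1 h2].
    split; apply is_derive_extend; auto; intros ->; reflexivity.
  - intros t ht. unfold X, Y. rewrite !extend_eq by lra. auto.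
Qed.

Lemma solves_opp (eps : R) (x y : R -> R) :
  solves eps x y -> solves eps (fun t => - x t) (fun t => - y t).
Proof.
  intros h t ht. destruct (h t ht) as [h1 h2]. split.
  - replace ((1 - (- x t) ^ 2) * (- x t - - y t))
      with (opp ((1 - x t ^ 2) * (x t - y t))) by (unfold opp; simpl; ring).
    apply (is_derive_opp x t _ h1).
  - replace (eps * - x t) with (opp (eps * x t)) by (unfold opp; simpl; ring).
    apply (is_derive_opp y t _ h2).
Qed.

Lemma solves_continuous (eps : R) (x y : R -> R) (t : R) :
  solves eps x y -> 0 <= t -> continuity_pt x t /\ continuity_pt y t.
Proof.
  intros h ht. destruct (h t ht) as [h1 h2].
  split; apply continuity_pt_filterlim.
  - apply (ex_derive_continuous x t). eexists; exact h1.
  - apply (ex_derive_continuous y t). eexists; exact h2.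
Qed.


Definition in_strip (x : R -> R) : Prop := forall t, 0 <= t -> -1 < x t < 1.

(** The function w = 1 - x^2 satisfies the linear equation w' = - 2 x (x - y) w,
    so it cannot reach 0: up to a zero c, the coefficient is bounded by a
    constant K, and w exp (K t) is nondecreasing while w >= 0. *)
Lemma strip_invariant (eps : R) (x y : R -> R) :
  solves eps x y -> -1 < x 0 < 1 -> in_strip x.
Proof.
  intros h h0.
  assert (hc : forall t, 0 <= t -> continuity_pt (fun s => 1 - x s ^ 2) t).
  { intros t ht. apply continuity_pt_filterlim.
    apply (ex_derive_continuous (fun s => 1 - x s ^ 2)).
    auto_derive. exists (((1 - x t ^ 2) * (x t - y t))). apply h, ht. }
  assert (hw : forall t, 0 <= t -> 0 < 1 - x t ^ 2).
  { intros b hb. apply Rnot_le_lt; intro hneg.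
    destruct (zero_before_sign_change (fun s => 1 - x s ^ 2) 0 b) as [c [hcb [hc0 hpos]]];
      try (simpl; nra).
    { intros t ht; apply hc; lra. }
    destruct (continuity_ab_maj (fun s => 2 * x s * (x s - y s)) 0 c)
      as [m [hm _]]; [lra| |].
    { intros t ht. destruct (h t (proj1 ht)) as [h1 h2].
      apply continuity_pt_filterlim.
      apply (ex_derive_continuous (fun s => 2 * x s * (x s - y s))).
      auto_derive. repeat split; eexists; eassumption. }
    set (K := 2 * x m * (x m - y m)) in hm.
    assert (hinc := increment_ge (fun s => (1 - x s ^ 2) * exp (K * s))
      (fun s => (K - 2 * x s * (x s - y s)) * ((1 - x s ^ 2) * exp (K * s))) 0 0 c).
    cbv beta in hinc. rewrite hc0 in hinc.
    rewrite Rmult_0_r, exp_0 in hinc.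
    assert ((1 - x 0 ^ 2) * 1 + 0 * (c - 0) <= 0 * exp (K * c)); [|nra].
    apply hinc; [lra| |].
    - intros t ht. destruct (h t (proj1 ht)) as [h1 _].
      auto_derive; [eexists; exact h1|].
      replace (Derive (fun z => x z) t) with ((1 - x t ^ 2) * (x t - y t))
        by (symmetry; apply is_derive_unique, h1). ring.
    - intros t ht. specialize (hm t ht). specialize (hpos t ht). cbv beta in hpos.
      apply Rmult_le_pos; [lra|].
      apply Rmult_le_pos; [lra|apply Rlt_le, exp_pos]. }
  intros t ht. specialize (hw t ht). nra.
Qed.

(** * Growth of the energy *)

(** In the coordinate u = artanh x this is y^2/2 + eps ln (cosh u): the system
    becomes u' = tanh u - y, y' = eps tanh u, a conservative oscillator to which
    the term tanh u adds energy. *)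
Definition energy (eps : R) (x y : R -> R) (t : R) : R :=
  y t ^ 2 / 2 - eps / 2 * ln (1 - x t ^ 2).

Lemma is_derive_energy (eps : R) (x y : R -> R) (t : R) :
  solves eps x y -> in_strip x -> 0 <= t ->
  is_derive (energy eps x y) t (eps * x t ^ 2).
Proof.
  intros h hs ht. destruct (h t ht) as [h1 h2]. specialize (hs t ht).
  assert (hw : 0 < 1 - x t ^ 2) by nra.
  unfold energy. auto_derive.
  - repeat split; [eexists; exact h2|eexists; exact h1|simpl in hw; lra].
  - replace (Derive (fun z => x z) t) with ((1 - x t ^ 2) * (x t - y t))
      by (symmetry; apply is_derive_unique, h1).
    replace (Derive (fun z => y z) t) with (eps * x t)
      by (symmetry; apply is_derive_unique, h2).
    field. simpl in hw. lra.
Qed.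

Lemma energy_monotone (eps : R) (x y : R -> R) (a b : R) :
  0 < eps -> solves eps x y -> in_strip x -> 0 <= a <= b ->
  energy eps x y a <= energy eps x y b.
Proof.
  intros heps h hs hab.
  assert (energy eps x y a + 0 * (b - a) <= energy eps x y b); [|lra].
  apply (increment_ge _ (fun t => eps * x t ^ 2)); [lra| |].
  - intros t ht. apply is_derive_energy; auto; lra.
  - intros t _. apply Rmult_le_pos; [lra|]. apply pow2_ge_0.
Qed.

Lemma ln_strip_le (z : R) : -1 < z < 1 -> ln (1 - z ^ 2) <= - z ^ 2.
Proof.
  intros hz. assert (0 < 1 - z ^ 2) by nra.
  rewrite <- (ln_exp (- z ^ 2)). apply ln_le; [lra|].
  generalize (exp_ineq1_le (- z ^ 2)). lra.
Qed.

(** The derivative of the energy vanishes on x = 0, so it gives no uniform growth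
    by itself.  Subtracting x y from a multiple of it adds (1 - x^2) y^2 to the
    derivative, which is positive there. *)
Lemma energy_unbounded (eps : R) (x y : R -> R) (M : R) :
  0 < eps -> solves eps x y -> in_strip x -> (x 0, y 0) <> (0, 0) ->
  exists s, 0 <= s /\ M <= energy eps x y s.
Proof.
  intros heps h hs hne. apply NNPP; intro hn.
  assert (hM : forall t, 0 <= t -> energy eps x y t < M).
  { intros t ht. apply Rnot_le_lt; intro hle. apply hn. eauto. }
  clear hn. set (H0 := energy eps x y 0).
  assert (hln : forall t, 0 <= t -> ln (1 - x t ^ 2) <= - x t ^ 2).
  { intros t ht. apply ln_strip_le, hs, ht. }
  assert (hH0 : 0 < H0).
  { unfold H0, energy. generalize (hln 0 (Rle_refl 0)); intro hl.
    assert (0 < y 0 ^ 2 + eps * x 0 ^ 2).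
    { destruct (Req_dec (y 0) 0) as [hy|hy].
      - assert (x 0 <> 0) by (intro hx; apply hne; rewrite hx, hy; reflexivity).
        generalize (pow2_gt_0 _ H). intro. rewrite hy. nra.
      - generalize (pow2_gt_0 _ hy) (pow2_ge_0 (x 0)). intros. nra. }
    nra. }
  (* An energy below M keeps x away from the boundary of the strip. *)
  set (m := exp (- (2 * M / eps))).
  assert (hm : forall t, 0 <= t -> m <= 1 - x t ^ 2).
  { intros t ht. assert (hw : 0 < 1 - x t ^ 2) by (specialize (hs t ht); nra).
    rewrite <- (exp_ln (1 - x t ^ 2)) by exact hw.
    apply exp_monotone. specialize (hM t ht). unfold energy in hM.
    assert (2 * M / eps * eps = 2 * M) by (field; lra).
    generalize (pow2_ge_0 (y t)); intro. nra. }
  assert (hm0 : 0 < m) by apply exp_pos.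
  (* An energy of at least H0 keeps the point away from the origin: one of its
     two terms is at least H0 / 2. *)
  set (rho := Rmin H0 (1 - exp (- (H0 / eps)))).
  assert (hrho0 : 0 < rho).
  { unfold rho. apply Rmin_pos; [exact hH0|].
    assert (exp (- (H0 / eps)) < exp 0); [|rewrite exp_0 in *; lra].
    apply exp_increasing. generalize (Rdiv_lt_0_compat _ _ hH0 heps). lra. }
  assert (hrho : forall t, 0 <= t -> rho <= x t ^ 2 + y t ^ 2).
  { intros t ht. assert (hw : 0 < 1 - x t ^ 2) by (specialize (hs t ht); nra).
    assert (hle : H0 <= energy eps x y t) by (apply energy_monotone; auto; lra).
    destruct (Rle_lt_dec H0 (y t ^ 2)) as [hy|hy].
    - generalize (Rmin_l H0 (1 - exp (- (H0 / eps)))) (pow2_ge_0 (x t)).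
      fold rho; lra.
    - generalize (Rmin_r H0 (1 - exp (- (H0 / eps)))) (pow2_ge_0 (y t)).
      fold rho. intros hr hy2.
      assert (1 - x t ^ 2 <= exp (- (H0 / eps))); [|lra].
      rewrite <- (exp_ln (1 - x t ^ 2)) by exact hw.
      apply exp_monotone. unfold energy in hle.
      assert (H0 / eps * eps = H0) by (field; lra). nra. }
  (* In V' the coefficient of x^2 is A eps - eps = 2, which dominates the part
     of the cross term (1 - x^2) x y that y^2 does not absorb. *)
  set (A := 1 + 2 / eps).
  assert (hA : A * eps = eps + 2) by (unfold A; field; lra).
  assert (hA0 : 0 < A) by (unfold A; generalize (Rdiv_lt_0_compat 2 eps); lra).
  set (V := fun t => A * energy eps x y t - x t * y t).
  set (dV := fun t => A * (eps * x t ^ 2)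
                 - ((1 - x t ^ 2) * (x t - y t) * y t + x t * (eps * x t))).
  set (c := m / 2 * rho).
  assert (hc : 0 < c) by (unfold c; apply Rmult_lt_0_compat; lra).
  assert (hV : forall t, 0 <= t -> V 0 + c * (t - 0) <= V t).
  { intros b hb. apply (increment_ge V dV); [exact hb| |].
    - intros t ht. destruct (h t (proj1 ht)) as [h1 h2].
      assert (h3 := is_derive_energy eps x y t h hs (proj1 ht)).
      unfold V. auto_derive.
      + repeat split; eexists; eassumption.
      + replace (Derive (fun z => x z) t) with ((1 - x t ^ 2) * (x t - y t))
          by (symmetry; apply is_derive_unique, h1).
        replace (Derive (fun z => y z) t) with (eps * x t)
          by (symmetry; apply is_derive_unique, h2).
        replace (Derive (fun z => energy eps x y z) t) with (eps * x t ^ 2)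
          by (symmetry; apply is_derive_unique, h3).
        unfold dV. ring.
    - intros t [ht _]. specialize (hm t ht). specialize (hrho t ht).
      assert (hw : 0 <= x t ^ 2 < 1) by (specialize (hs t ht); nra).
      assert (hge : (1 - x t ^ 2) / 2 * (x t ^ 2 + y t ^ 2) <= dV t).
      { replace (dV t) with ((A * eps - eps) * x t ^ 2
          + (1 - x t ^ 2) * (y t ^ 2 - x t * y t)) by (unfold dV; ring).
        rewrite hA.
        assert (0 <= (1 - x t ^ 2) * (x t - y t) ^ 2)
          by (apply Rmult_le_pos; [lra|apply pow2_ge_0]).
        nra. }
      apply Rle_trans with (2 := hge). unfold c.
      apply Rmult_le_compat; lra. }
  set (B := A * M + 2 * M + 1).
  assert (hB : forall t, 0 <= t -> V t < B).
  { intros t ht. specialize (hM t ht). specialize (hs t ht).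
    assert (hy : y t ^ 2 / 2 < M).
    { unfold energy in hM. generalize (hln t ht) (pow2_ge_0 (x t)).
      intros. nra. }
    assert (A * energy eps x y t < A * M) by (apply Rmult_lt_compat_l; lra).
    assert (- (x t * y t) <= y t ^ 2 + 1).
    { assert (x t ^ 2 < 1) by nra. generalize (pow2_ge_0 (x t + y t)). nra. }
    unfold V, B. lra. }
  (* At this time the linear lower bound on V reaches B. *)
  set (t := (Rmax 0 (B - V 0)) / c).
  assert (ht : t * c = Rmax 0 (B - V 0)) by (unfold t; field; lra).
  assert (ht0 : 0 <= t) by (unfold t; apply Rdiv_le_0_compat; [apply Rmax_l|lra]).
  specialize (hV t ht0). specialize (hB t ht0).
  generalize (Rmax_r 0 (B - V 0)). nra.
Qed.

(** * Recurrence *)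

(** While y >= 1, x decreases, at a rate bounded below as long as x >= -1/2
    because 1 - x does not shrink.  So x falls below -1/2 and remains there;
    then y decreases at rate at least eps/2, which contradicts y >= 1. *)
Lemma y_returns_below (eps : R) (x y : R -> R) (s : R) :
  0 < eps -> solves eps x y -> in_strip x -> 0 <= s ->
  exists t, s <= t /\ y t < 1.
Proof.
  intros heps h hs hs0. apply NNPP; intro hn.
  assert (hy : forall t, s <= t -> 1 <= y t).
  { intros t ht. apply Rnot_lt_le; intro hlt. apply hn. eauto. }
  clear hn.
  assert (hdec : forall a b, s <= a <= b -> x b <= x a).
  { intros a b hab.
    assert (- x a + 0 * (b - a) <= - x b); [|lra].
    apply (increment_ge (fun t => - x t)
             (fun t => (1 - (- x t) ^ 2) * (- x t - - y t))); [lra| |].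
    - intros t ht. apply (solves_opp eps x y h t); lra.
    - intros t ht. assert (hx : -1 < x t < 1) by (apply hs; lra).
      assert (1 <= y t) by (apply hy; lra).
      apply Rmult_le_pos; nra. }
  assert (hneg : exists t, s <= t /\ x t < - / 2).
  { apply NNPP; intro hn.
    assert (hx : forall t, s <= t -> - / 2 <= x t).
    { intros t ht. apply Rnot_lt_le; intro hlt. apply hn. eauto. }
    set (d := 1 - x s).
    assert (hd : 0 < d) by (unfold d; specialize (hs s hs0); lra).
    assert (hinc : forall b, s <= b -> - x s + d ^ 2 / 2 * (b - s) <= - x b).
    { intros b hb.
      apply (increment_ge (fun t => - x t)
             (fun t => (1 - (- x t) ^ 2) * (- x t - - y t))); [lra| |].
      - intros t ht. apply (solves_opp eps x y h t); lra.
      - intros t ht. specialize (hx t (proj1 ht)).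
        assert (hx1 : -1 < x t < 1) by (apply hs; lra).
        assert (1 <= y t) by (apply hy; lra).
        assert (x t <= x s) by (apply hdec; lra).
        replace (d ^ 2 / 2) with ((d / 2) * d) by field.
        apply Rmult_le_compat; unfold d in *; nra. }
    specialize (hinc (s + 4 / d ^ 2)).
    assert (hd2 : 0 < d ^ 2) by (apply pow_lt, hd).
    assert (h4 : 0 < 4 / d ^ 2) by (apply Rdiv_lt_0_compat; lra).
    replace (d ^ 2 / 2 * (s + 4 / d ^ 2 - s)) with 2 in hinc by (field; lra).
    assert (-1 < x (s + 4 / d ^ 2) < 1) by (apply hs; lra).
    specialize (hs s hs0). lra. }
  destruct hneg as [a [ha hxa]].
  assert (hinc : forall b, a <= b -> - y a + eps / 2 * (b - a) <= - y b).
  { intros b hb.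
    apply (increment_ge (fun t => - y t) (fun t => eps * - x t)); [lra| |].
    - intros t ht. apply (solves_opp eps x y h t); lra.
    - intros t ht. assert (x t <= x a) by (apply hdec; lra). nra. }
  assert (hya := hy a ha).
  assert (hq : 0 < 2 * y a / eps) by (apply Rdiv_lt_0_compat; lra).
  specialize (hinc (a + 2 * y a / eps)).
  specialize (hy (a + 2 * y a / eps)).
  replace (eps / 2 * (a + 2 * y a / eps - a)) with (y a) in hinc by (field; lra).
  lra.
Qed.

Lemma in_strip_opp (x : R -> R) : in_strip x -> in_strip (fun t => - x t).
Proof. intros hs t ht. specialize (hs t ht). lra. Qed.

(** By symmetry y also returns above -1; continuity excludes a jump over the
    band. *)
Lemma y_recurrent (eps : R) (x y : R -> R) (s : R) :
  0 < eps -> solves eps x y -> in_strip x -> 0 <= s ->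
  exists t, s <= t /\ -1 <= y t <= 1.
Proof.
  intros heps h hs hs0.
  destruct (y_returns_below eps x y s) as [a [ha hya]]; auto.
  destruct (y_returns_below eps (fun t => - x t) (fun t => - y t) a)
    as [b [hb hyb]]; auto using solves_opp, in_strip_opp; [lra|].
  destruct (Rle_lt_dec (-1) (y a)) as [h1|h1]; [exists a; lra|].
  destruct (Rle_lt_dec (y b) 1) as [h2|h2]; [exists b; lra|].
  destruct (zero_before_sign_change (fun t => - y t) a b) as [c [hc [hc0 _]]]; try lra.
  - intros t ht. apply continuity_pt_opp.
    apply (solves_continuous eps x y t h); lra.
  - exists c. lra.
Qed.

(** * Passage along the repulsive half-lines *)

(** The threshold solves 1/2 - (eps/2) ln eta = H: when y^2/2 is at most 1/2, the
    rest of the energy must come from the logarithm. *)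
Lemma energy_confines (eps : R) (x y : R -> R) (eta t : R) :
  0 < eps -> 0 < eta -> -1 < x t < 1 -> -1 <= y t <= 1 ->
  (1 - eps * ln eta) / 2 <= energy eps x y t -> 1 - x t ^ 2 <= eta.
Proof.
  intros heps heta hx hy hE.
  assert (hw : 0 < 1 - x t ^ 2) by nra.
  assert (y t ^ 2 <= 1) by nra.
  rewrite <- (exp_ln (1 - x t ^ 2)), <- (exp_ln eta) by assumption.
  apply exp_monotone. unfold energy in hE. nra.
Qed.

(** While x >= 0, y does not decrease, so it stays above -1.  Until y reaches 1
    the solution is then in the band where x is confined near 1 or -1; hence x
    cannot cross 0, it stays above 1/2, and y increases at rate at least
    eps/2. *)
Lemma reaches_one (eps : R) (x y : R -> R) (s : R) :
  0 < eps -> solves eps x y -> in_strip x -> 0 <= s ->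
  (forall t, s <= t -> -1 <= y t <= 1 -> 1 - x t ^ 2 <= / 2) ->
  -1 <= y s <= 1 -> 0 < x s ->
  exists t, s <= t /\ y t = 1 /\ 0 < x t.
Proof.
  intros heps h hs hs0 hconf hys hxs.
  apply NNPP; intro hn.
  assert (hmono : forall b, s <= b ->
    (forall t, s <= t <= b -> 0 <= x t) -> y s <= y b).
  { intros b hb hx.
    assert (y s + 0 * (b - s) <= y b); [|lra].
    apply (increment_ge y (fun t => eps * x t)); [lra| |].
    - intros t ht. apply (h t); lra.
    - intros t ht. specialize (hx t ht). nra. }
  assert (hbelow : forall b, s <= b ->
    (forall t, s <= t <= b -> 0 <= x t) -> y b < 1).
  { intros b hb hx. apply Rnot_le_lt; intro hyb. apply hn.
    destruct (Rle_lt_or_eq_dec _ _ (proj2 hys)) as [hlt|heq];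
      [|exists s; repeat split; lra].
    destruct (zero_before_sign_change (fun t => 1 - y t) s b) as [c [hc [hc0 _]]]; try lra.
    - intros t ht. apply continuity_pt_minus;
        [apply continuity_pt_const; intros ? ?; reflexivity|].
      apply (solves_continuous eps x y t h); lra.
    - exists c. specialize (hx c hc). specialize (hconf c).
      repeat split; try lra.
      destruct hx as [hx|hx]; [exact hx|]. rewrite <- hx in hconf. lra. }
  assert (hpos : forall t, s <= t -> 0 < x t).
  { intros b hb. apply Rnot_le_lt; intro hxb.
    destruct (zero_before_sign_change x s b) as [c [hc [hc0 hbefore]]]; try lra.
    - intros t ht. apply (solves_continuous eps x y t h); lra.
    - assert (h1 := hmono c (proj1 hc) hbefore).
      assert (h2 := hbelow c (proj1 hc) hbefore).
      specialize (hconf c). rewrite hc0 in hconf. lra. }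
  assert (hnonneg : forall b t, s <= t <= b -> 0 <= x t)
    by (intros b t ht; left; apply hpos; lra).
  assert (hhalf : forall t, s <= t -> / 2 <= x t).
  { intros t ht. specialize (hmono t ht (hnonneg t)).
    specialize (hbelow t ht (hnonneg t)). specialize (hpos t ht).
    specialize (hconf t ht). assert (x t < 1) by (apply hs; lra).
    assert (1 - x t ^ 2 <= / 2) by (apply hconf; lra). nra. }
  set (b := s + 4 / eps).
  assert (hb : s <= b)
    by (unfold b; assert (0 < 4 / eps) by (apply Rdiv_lt_0_compat; lra); lra).
  assert (hinc : y s + eps / 2 * (b - s) <= y b).
  { apply (increment_ge y (fun t => eps * x t)); [exact hb| |].
    - intros t ht. apply (h t); lra.
    - intros t ht. specialize (hhalf t (proj1 ht)). nra. }
  replace (eps / 2 * (b - s)) with 2 in hinc by (unfold b; field; lra).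
  specialize (hbelow b hb (hnonneg b)). lra.
Qed.

(** The function 1 - x satisfies (1 - x)' = (1 + x)(y - x)(1 - x).  Here
    1 + x <= 2 and y <= 1 + eps L, so y - x <= 2 + eps L, and Gronwall's
    inequality applies. *)
Lemma stays_near_one (eps : R) (x y : R -> R) (s L : R) :
  0 < eps -> solves eps x y -> in_strip x -> 0 <= s -> 0 <= L -> y s = 1 ->
  forall t, s <= t <= s + L ->
    1 - x t <= (1 - x s) * exp (2 * (2 + eps * L) * L).
Proof.
  intros heps h hs hs0 hL hys t ht.
  set (K := 2 * (2 + eps * L)).
  assert (hy : forall r, s <= r <= s + L -> y r <= 1 + eps * L).
  { intros r hr.
    assert (- y s + (- eps) * (r - s) <= - y r); [|nra].
    apply (increment_ge (fun t => - y t) (fun t => eps * - x t)); [lra| |].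
    - intros q hq. apply (solves_opp eps x y h q); lra.
    - intros q hq. assert (-1 < x q < 1) by (apply hs; lra). nra. }
  assert (hinc : - (1 - x s) * exp (- K * (s - s)) + 0 * (t - s)
                 <= - (1 - x t) * exp (- K * (t - s))).
  { apply (increment_ge (fun r => - (1 - x r) * exp (- K * (r - s)))
      (fun r => (K - (1 + x r) * (y r - x r))
                * ((1 - x r) * exp (- K * (r - s))))); [lra| |].
    - intros r hr. destruct (h r) as [h1 _]; [lra|].
      auto_derive; [eexists; exact h1|].
      replace (Derive (fun z => x z) r) with ((1 - x r ^ 2) * (x r - y r))
        by (symmetry; apply is_derive_unique, h1).
      unfold Rminus; ring.
    - intros r hr. assert (hx : -1 < x r < 1) by (apply hs; lra).
      assert (hyr : y r <= 1 + eps * L) by (apply hy; lra).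
      assert (0 <= eps * L) by nra.
      apply Rmult_le_pos; [unfold K; nra|].
      apply Rmult_le_pos; [lra|left; apply exp_pos]. }
  rewrite Rminus_diag, Rmult_0_r, exp_0 in hinc.
  assert (he : exp (- K * (t - s)) * exp (K * (t - s)) = 1).
  { rewrite <- exp_plus. replace (_ + _) with 0 by ring. apply exp_0. }
  assert (hxs : 0 < 1 - x s) by (specialize (hs s hs0); lra).
  assert (hK : 0 <= K) by (unfold K; nra).
  assert (hle : exp (K * (t - s)) <= exp (K * L)) by (apply exp_monotone; nra).
  generalize (exp_pos (K * (t - s))); intro hp.
  apply Rle_trans with ((1 - x s) * exp (K * (t - s))).
  - replace (1 - x t) with ((1 - x t) * exp (- K * (t - s)) * exp (K * (t - s)))
      by (rewrite Rmult_assoc, he; ring).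
    apply Rmult_le_compat_r; lra.
  - apply Rmult_le_compat_l; lra.
Qed.

(** The confinement in the band is chosen with the inverse of the expansion factor
    over a time L, so that 1 - x is still at most delta / 2 at the end.  The
    initial time is excluded because y = 1 there, while the half-line is open. *)
Lemma long_passage (eps : R) (x y : R -> R) (s delta L : R) :
  0 < eps -> solves eps x y -> in_strip x -> 0 <= s ->
  0 < delta < 1 -> 0 < L ->
  (forall t, s <= t -> -1 <= y t <= 1 ->
     1 - x t ^ 2 <= delta / 2 * exp (- (2 * (2 + eps * L) * L))) ->
  -1 <= y s <= 1 -> 0 < x s ->
  exists a, 0 <= a /\
    forall t, a < t <= a + L -> 1 - delta < x t < 1 /\ 1 < y t.
Proof.
  intros heps h hs hs0 hd hL hconf hys hxs.
  set (E := exp (2 * (2 + eps * L) * L)).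
  assert (hE : delta / 2 * exp (- (2 * (2 + eps * L) * L)) * E = delta / 2).
  { unfold E. rewrite Rmult_assoc, <- exp_plus, Rplus_opp_l, exp_0. ring. }
  assert (hE1 : 1 <= E).
  { unfold E. rewrite <- exp_0. apply exp_monotone. nra. }
  set (eta := delta / 2 * exp (- (2 * (2 + eps * L) * L))) in *.
  destruct (reaches_one eps x y s) as [a [ha [hya hxa]]]; auto.
  { intros t ht hyt. specialize (hconf t ht hyt). nra. }
  exists a. split; [lra|].
  assert (hxa1 : -1 < x a < 1) by (apply hs; lra).
  assert (hnear : 1 - x a <= eta).
  { apply Rle_trans with (1 - x a ^ 2); [nra|apply hconf; lra]. }
  assert (hx : forall t, a <= t <= a + L -> 1 - delta < x t < 1).
  { intros t ht. assert (-1 < x t < 1) by (apply hs; lra).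
    assert (1 - x t <= (1 - x a) * E)
      by (apply (stays_near_one eps x y a L); auto; lra).
    nra. }
  intros t ht. split; [apply hx; lra|].
  assert (y a + eps * (1 - delta) * (t - a) <= y t).
  { apply (increment_ge y (fun t => eps * x t)); [lra| |].
    - intros r hr. apply (h r); lra.
    - intros r hr. assert (1 - delta < x r < 1) by (apply hx; lra). nra. }
  assert (0 < eps * (1 - delta) * (t - a)); [|lra].
  apply Rmult_lt_0_compat; [apply Rmult_lt_0_compat|]; lra.
Qed.

(** * Distance to the repulsive half-lines *)

(** The point at the same height on the half-line bounds the distance. *)
Lemma dist_repulsive_lt (u v c delta : R) :
  repulsive_part (c, v) -> Rabs (u - c) < delta ->
  Rbar_lt (dist_to_set (u, v) repulsive_part) (Finite delta).
Proof.
  intros hR hd.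
  apply Rbar_le_lt_trans with (Finite (Rabs (u - c))); [|exact hd].
  unfold dist_to_set. destruct (Glb_Rbar_correct (fun d => exists q,
    repulsive_part q /\ d = dist_euc (fst (u, v)) (snd (u, v)) (fst q) (snd q)))
    as [hlb _].
  apply hlb. exists (c, v). split; [exact hR|].
  simpl. unfold dist_euc. rewrite Rminus_diag, <- sqrt_Rsqr_abs.
  f_equal. unfold Rsqr. ring.
Qed.

Theorem mainTheorem1 (eps : R) (heps : 0 < eps)
  (x0 y0 : R) (hx0 : -1 < x0 < 1) (hne : (x0, y0) <> (0, 0))
  (delta : R) (hdelta : 0 < delta) (T : R) (hT : 0 < T)
  (x y : R -> R) (hsol : is_solution eps x y)
  (hinit : x 0 = x0 /\ y 0 = y0) :
  exists a b : R, 0 <= a /\ T < b - a /\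
    forall t : R, a <= t <= b ->
      Rbar_lt (dist_to_set (x t, y t) repulsive_part) (Finite delta).
Proof.
  destruct (solution_extends eps x y hsol) as [X [Y [h hXY]]].
  destruct hinit as [hx hy]. destruct (hXY 0 (Rle_refl 0)) as [hX hY].
  rewrite <- hx, <- hX in hx0. rewrite <- hx, <- hX, <- hy, <- hY in hne.
  assert (hs := strip_invariant eps X Y h hx0).
  set (d := Rmin delta (/ 2)).
  assert (hd : 0 < d < 1 /\ d <= delta).
  { generalize (Rmin_l delta (/ 2)) (Rmin_r delta (/ 2))
      (Rmin_pos delta (/ 2) hdelta). fold d. lra. }
  (* The passage is used from a + 1 to a + L, an interval of length T + 1. *)
  set (L := T + 2).
  set (eta := d / 2 * exp (- (2 * (2 + eps * L) * L))).
  assert (heta : 0 < eta)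
    by (apply Rmult_lt_0_compat; [lra|apply exp_pos]).
  destruct (energy_unbounded eps X Y ((1 - eps * ln eta) / 2))
    as [s0 [hs0 hE]]; auto.
  assert (hconf : forall t, s0 <= t -> -1 <= Y t <= 1 -> 1 - X t ^ 2 <= eta).
  { intros t ht hYt. apply (energy_confines eps X Y); auto.
    - apply hs; lra.
    - apply Rle_trans with (1 := hE). apply energy_monotone; auto; lra. }
  destruct (y_recurrent eps X Y s0) as [s [hss hYs]]; auto.
  assert (hXs : X s <> 0).
  { intro h0. specialize (hconf s hss hYs). rewrite h0 in hconf.
    assert (exp (- (2 * (2 + eps * L) * L)) < 1); [|unfold eta in hconf; nra].
    rewrite <- exp_0. apply exp_increasing.
    assert (0 < eps * L) by (unfold L; nra). unfold L in *; nra. }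
  (* For x near -1, pass to the mirror solution. *)
  destruct (Rdichotomy _ _ hXs) as [hneg|hpos].
  - destruct (long_passage eps (fun t => - X t) (fun t => - Y t) s d L)
      as [a [ha hgo]]; auto using solves_opp, in_strip_opp;
      try (unfold L in *; lra).
    { intros t ht hYt. replace ((- X t) ^ 2) with (X t ^ 2) by ring.
      apply hconf; lra. }
    exists (a + 1), (a + L). unfold L in *. repeat split; [lra|lra|].
    intros t ht. destruct (hXY t) as [<- <-]; [lra|].
    destruct (hgo t) as [h1 h2]; [lra|].
    apply dist_repulsive_lt with (-1); [left; simpl; lra|].
    apply Rabs_def1; lra.
  - destruct (long_passage eps X Y s d L) as [a [ha hgo]]; auto;
      try (unfold L in *; lra).
    { intros t ht hYt. apply hconf; lra. }
    exists (a + 1), (a + L). unfold L in *. repeat split; [lra|lra|].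
    intros t ht. destruct (hXY t) as [<- <-]; [lra|].
    destruct (hgo t) as [h1 h2]; [lra|].
    apply dist_repulsive_lt with 1; [right; simpl; lra|].
    apply Rabs_def1; lra.
Qed.
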